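(* The Picard modular group $SU(2,1;\mathbf{Z}[i])$ is generated by the Heisenberg translations $$N_{(0,i)}=\begin{pmatrix}1&0&0\\0&1&0\\i&0&1\end{pmatrix},\qquad N_{(1+i,1)}=\begin{pmatrix}1&0&0\\1+i&1&0\\1&1-i&1\end{pmatrix},$$ the rotation by $i$ in the first coordinate $$M_i=\begin{pmatrix}i&0&0\\0&-1&0\\0&0&i\end{pmatrix},$$ and the involution $$J=\begin{pmatrix}0&0&-1\\0&-1&0\\-1&0&0\end{pmatrix}.$$
   Context: Let $C=\begin{pmatrix}0&0&-1\\0&1&0\\-1&0&0\end{pmatrix}$. The group $SU(2,1)$ is the group of complex $3\times 3$ matrices $G$ with $\det G=1$ and $G^*CG=C$, where $G^*$ is the conjugate transpose. The Picard modular group $SU(2,1;\mathbf{Z}[i])$ is the subgroup of those $G\in SU(2,1)$ all of whose entries lie in the ring of Gaussian integers $\mathbf{Z}[i]$. *)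

(* Defs.v *)
From mathcomp Require Import all_boot all_order all_algebra.
From mathcomp Require Import boolp classical_sets reals.
From mathcomp Require Export complex.

Set Implicit Arguments.
Unset Strict Implicit.
Unset Printing Implicit Defensive.

Import Order.TTheory GRing.Theory Num.Theory.

Local Open Scope classical_set_scope.
Local Open Scope ring_scope.
Local Open Scope complex_scope.
Local Open Scope sesquilinear_scope.

(* The complex numbers are R[i] for a realType R (any model of the reals). *)

Definition mx3 (T : nmodType) (rows : seq (seq T)) : 'M[T]_3 :=
  \matrix_(i < 3, j < 3) nth 0 (nth [::] rows i) j.

Definition hermC (R : realType) : 'M[R[i]]_3 :=
  mx3 [:: [::  0; 0; -1];
          [::  0; 1;  0];
          [:: -1; 0;  0]].

(* [G ^t*] is the conjugate transpose. *)
Definition SU21 (R : realType) : set 'M[R[i]]_3 :=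
  [set G | \det G = 1 /\ G ^t* *m hermC R *m G = hermC R].
Arguments SU21 : clear implicits.

Definition gaussian_integer (R : realType) : set R[i] :=
  [set z | exists a b : int, z = a%:~R +i* b%:~R].

Definition picard (R : realType) : set 'M[R[i]]_3 :=
  SU21 R `&` [set G | forall i j, gaussian_integer (G i j)].
Arguments picard : clear implicits.

(* Subgroups of the group of units of a ring. The first clause is needed
   because [x^-1 = x] when [x] is not a unit. *)
Definition unit_subgroup (A : unitRingType) (H : set A) : Prop :=
  [/\ forall x, H x -> x \is a GRing.unit,
      H 1,
      forall x y, H x -> H y -> H (x * y)
    & forall x, H x -> H x^-1].

(* The subgroup generated by [S], for a set [S] of units: the intersection
   of all subgroups containing [S]. *)
Definition subgroup_generated (A : unitRingType) (S : set A) : set A :=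
  smallest (@unit_subgroup A) S.

Definition N_0_i (R : realType) : 'M[R[i]]_3 :=
  mx3 [:: [:: 1 ; 0; 0];
          [:: 0 ; 1; 0];
          [:: 'i; 0; 1]].

Definition N_1i_1 (R : realType) : 'M[R[i]]_3 :=
  mx3 [:: [:: 1     ; 0     ; 0];
          [:: 1 + 'i; 1     ; 0];
          [:: 1     ; 1 - 'i; 1]].

Definition M_i (R : realType) : 'M[R[i]]_3 :=
  mx3 [:: [:: 'i;  0; 0];
          [:: 0 ; -1; 0];
          [:: 0 ;  0; 'i]].

Definition invJ (R : realType) : 'M[R[i]]_3 :=
  mx3 [:: [::  0;  0; -1];
          [::  0; -1;  0];
          [:: -1;  0;  0]].

(* Main.v *)
(* Call a vector (a,b,c) isotropic when |b|^2 = 2 Re(a conj(c)); the outer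
   columns of a Picard matrix are isotropic with Gaussian entries. If a <> 0, the
   lower triangular generators bring |b|^2 below |a|^2 and |Im(conj(a) c)| below
   |a|^2 / 2, so that |c|^2 |a|^2 = |b|^4 / 4 + Im(conj(a) c)^2 <= |a|^4 / 2; since
   J exchanges a and c up to sign, iterating on the left of a Picard matrix makes
   its first column a multiple of e3. The first entry of its third column is then a unit,
   so the same reduction, which preserves the line of e3, makes the third column
   a multiple of e1. What remains is an antidiagonal matrix M_i^k J. *)
From mathcomp Require Import all_boot all_order all_algebra.
From mathcomp Require Import boolp classical_sets reals.
From mathcomp Require Import ring lra zify.
Require Import Defs.

Set Implicit Arguments.
Unset Strict Implicit.
Unset Printing Implicit Defensive.

Import Order.TTheory GRing.Theory Num.Theory.

Local Open Scope classical_set_scope.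
Local Open Scope ring_scope.
Local Open Scope complex_scope.
Local Open Scope sesquilinear_scope.

(** * Entrywise calculus for matrices of size three, and generated subgroups *)

Lemma forall_I3 (P : 'I_3 -> Prop) : P 0 -> P 1 -> P 2 -> forall i, P i.
Proof.
move=> P0 P1 P2 [[|[|[|//]]] lti].
- by rewrite (_ : Ordinal lti = 0) //; apply: val_inj.
- by rewrite (_ : Ordinal lti = 1) //; apply: val_inj.
- by rewrite (_ : Ordinal lti = 2) //; apply: val_inj.
Qed.

Lemma sum_I3 (V : nmodType) (F : 'I_3 -> V) : \sum_i F i = F 0 + F 1 + F 2.
Proof.
rewrite !big_ord_recr big_ord0 /= add0r.
by congr (F _ + F _ + F _); apply: val_inj.
Qed.

Lemma mulmx3E (T : pzSemiRingType) m n (A : 'M[T]_(m, 3)) (B : 'M_(3, n)) i j :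
  (A *m B) i j = A i 0 * B 0 j + A i 1 * B 1 j + A i 2 * B 2 j.
Proof. by rewrite mxE sum_I3. Qed.

Lemma det3 (T : comPzRingType) (A : 'M[T]_3) :
  \det A = A 0 0 * (A 1 1 * A 2 2 - A 1 2 * A 2 1)
         - A 0 1 * (A 1 0 * A 2 2 - A 1 2 * A 2 0)
         + A 0 2 * (A 1 0 * A 2 1 - A 1 1 * A 2 0).
Proof.
have det2 (B : 'M[T]_2) : \det B = B 0 0 * B 1 1 - B 0 1 * B 1 0.
  rewrite (expand_det_row _ 0) !big_ord_recr big_ord0 /= add0r /cofactor !det_mx11.
  rewrite !mxE /= expr0 expr1 mul1r mulN1r mulrN.
  by congr (B _ _ * B _ _ - B _ _ * B _ _); apply: val_inj.
rewrite (expand_det_row _ 0) sum_I3 /cofactor !det2 !mxE /=.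
rewrite !(mul1r, expr0, expr1, mulN1r, sqrrN, expr1n, mulrN).
by congr (A _ _ * (A _ _ * A _ _ - A _ _ * A _ _)
  - A _ _ * (A _ _ * A _ _ - A _ _ * A _ _)
  + A _ _ * (A _ _ * A _ _ - A _ _ * A _ _)); apply: val_inj.
Qed.

Lemma mx3E (T : nmodType) (a b c d e f g h k : T) :
  let A := mx3 [:: [:: a; b; c]; [:: d; e; f]; [:: g; h; k]] in
  (((A 0 0 = a) * (A 0 1 = b) * (A 0 2 = c)) *
   ((A 1 0 = d) * (A 1 1 = e) * (A 1 2 = f)) *
   ((A 2 0 = g) * (A 2 1 = h) * (A 2 2 = k)))%type.
Proof. by rewrite /= !mxE. Qed.

(** [P] is itself a member of the family being intersected, so every generated element lies in it
    and is a unit. *)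
Lemma unit_subgroup_generated (A : unitRingType) (S P : set A) :
  unit_subgroup P -> S `<=` P -> unit_subgroup (subgroup_generated S).
Proof.
move=> PP SP; split.
- by move=> x /(_ P (conj PP SP)); case: PP => + _ _ _; apply.
- by move=> Q [[]].
- by move=> x y Sx Sy Q QS; have [[_ _ + _] _] := QS; apply; [apply: Sx|apply: Sy].
- by move=> x Sx Q QS; have [[_ _ _ +] _] := QS; apply; apply: Sx.
Qed.

Lemma col_mul (T : pzSemiRingType) m n p (A : 'M[T]_(m, n)) (B : 'M_(n, p)) j :
  col j (A *m B) = A *m col j B.
Proof. by rewrite !colE mulmxA. Qed.

(** * Norm inequalities and units of the Gaussian integers, in integer coordinates *)

Lemma sqrz_sum_eq0 (x y : int) : x ^+ 2 + y ^+ 2 = 0 -> x = 0 /\ y = 0.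
Proof.
by move/eqP; rewrite paddr_eq0 ?sqr_ge0 // !sqrf_eq0 => /andP[/eqP-> /eqP->].
Qed.

(* |b + (1 + i) a|^2 = |b|^2 + 2 na + 2 s, and t takes the place of s once (a, b)
   is replaced by (i a, - b), as M_i does. *)
Lemma translation_choice (a1 a2 b1 b2 : int) :
  let na := a1 ^+ 2 + a2 ^+ 2 in
  let s := b1 * (a1 - a2) + b2 * (a1 + a2) in
  let t := b1 * (a1 + a2) + b2 * (a2 - a1) in
  0 < na -> na < b1 ^+ 2 + b2 ^+ 2 -> [\/ s < - na, na < s, t < - na | na < t].
Proof.
move=> na s t na_gt0 lt_ab.
have [?|les1] := ltP s (- na); first by constructor 1.
have [?|les2] := ltP na s; first by constructor 2.
have [?|let1] := ltP t (- na); first by constructor 3.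
have [?|let2] := ltP na t; first by constructor 4.
(* [s] and [t] are the real and imaginary parts of conj(b) (1 + i) a, whose squared modulus is 2
   |a|^2 |b|^2. If both were at most [na] in absolute value, this would be at most 2 [na]^2, against
   |a| < |b|. *)
have st : s ^+ 2 + t ^+ 2 = 2 * (na * (b1 ^+ 2 + b2 ^+ 2)).
  by rewrite /s /t /na; ring.
have s2 : 0 <= (na - s) * (na + s) by apply: mulr_ge0; lra.
have t2 : 0 <= (na - t) * (na + t) by apply: mulr_ge0; lra.
have : 0 < na * (b1 ^+ 2 + b2 ^+ 2 - na) by rewrite mulr_gt0 // subr_gt0.
by move: st s2 t2; rewrite -/na; clearbody s t na; lra.
Qed.

(** The hypotheses say conj(a) c = 1. Taking norms gives |a| = 1, so c is the inverse of conj(a),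
    which is a itself. *)
Lemma gaussian_units (a1 a2 c1 c2 : int) :
  c1 * a1 + c2 * a2 = 1 -> c1 * a2 = c2 * a1 ->
  [/\ c1 = a1, c2 = a2, a1 ^+ 2 + a2 ^+ 2 = 1 &
   [\/ a1 = 1 /\ a2 = 0, a1 = -1 /\ a2 = 0, a1 = 0 /\ a2 = 1 | a1 = 0 /\ a2 = -1]].
Proof.
move=> re im.
have Nac : (a1 ^+ 2 + a2 ^+ 2) * (c1 ^+ 2 + c2 ^+ 2) = 1.
  transitivity ((c1 * a1 + c2 * a2) ^+ 2 + (c1 * a2 - c2 * a1) ^+ 2); first by ring.
  by rewrite re im; ring.
have Na : a1 ^+ 2 + a2 ^+ 2 = 1.
  have a0 : 0 <= a1 ^+ 2 + a2 ^+ 2 by rewrite addr_ge0 ?sqr_ge0.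
  have /eqP := congr1 absz Nac; rewrite abszM muln_eq1 => /andP[/eqP + _].
  by move: (a1 ^+ 2 + _) a0 => x; clear; lia.
have -> : c1 = a1.
  transitivity (c1 * (a1 ^+ 2 + a2 ^+ 2)); first by rewrite Na mulr1.
  transitivity (a1 * (c1 * a1) + a2 * (c1 * a2)); first by ring.
  transitivity (a1 * (c1 * a1 + c2 * a2)); first by rewrite im; ring.
  by rewrite re mulr1.
have -> : c2 = a2.
  transitivity (c2 * (a1 ^+ 2 + a2 ^+ 2)); first by rewrite Na mulr1.
  transitivity (a2 * (c2 * a2) + a1 * (c2 * a1)); first by ring.
  transitivity (a2 * (c1 * a1 + c2 * a2)); first by rewrite -im; ring.
  by rewrite re mulr1.
split=> //.
have a1b : -1 <= a1 <= 1 by clear - Na; nia.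
have a2b : -1 <= a2 <= 1 by clear - Na; nia.
have : a1 = 0 \/ a1 = 1 \/ a1 = -1 by clear - a1b; lia.
have : a2 = 0 \/ a2 = 1 \/ a2 = -1 by clear - a2b; lia.
move: Na; clear => Na [|[]] E2 [|[]] E1; subst a1 a2; move: Na => //= _.
- by constructor 1.
- by constructor 2.
- by constructor 3.
- by constructor 4.
Qed.

(** * Gaussian numbers in integer coordinates, and the generators written with them *)

Section Picard.
Variable R : realType.
Local Notation C := R[i].
Local Notation generators := [set N_0_i R; N_1i_1 R; M_i R; invJ R].

(** With integer coordinates, [gzE] collapses a polynomial expression in Gaussian numbers to a
    single [gz], and what remains is integer arithmetic for [ring], [lra] and [lia]. *)
Definition gz (x y : int) : C := x%:~R +i* y%:~R.

Lemma gz0 : 0 = gz 0 0. Proof. by []. Qed.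
Lemma gz1 : 1 = gz 1 0. Proof. by []. Qed.
Lemma gzD x y z t : gz x y + gz z t = gz (x + z) (y + t).
Proof. by rewrite /gz !rmorphD. Qed.
Lemma gzN x y : - gz x y = gz (- x) (- y).
Proof. by rewrite /gz !rmorphN. Qed.
Lemma gzM x y z t : gz x y * gz z t = gz (x * z - y * t) (x * t + y * z).
Proof. by rewrite /gz !(rmorphB, rmorphD, rmorphM) /=. Qed.
Lemma gz_conj x y : (gz x y)^* = gz x (- y).
Proof. by rewrite /gz rmorphN. Qed.
Lemma gz_conjC x y : Num.conj (gz x y) = gz x (- y).
Proof. exact: gz_conj. Qed.
Lemma gz_inj x y z t : gz x y = gz z t -> x = z /\ y = t.
Proof. by case=> /intr_inj -> /intr_inj ->. Qed.

Definition gzE := (gz0, gz1, gz_conjC, gzN, gzM, gzD).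

Lemma hermCE : hermC R = mx3
  [:: [:: gz 0 0; gz 0 0; gz (-1) 0];
      [:: gz 0 0; gz 1 0; gz 0 0];
      [:: gz (-1) 0; gz 0 0; gz 0 0]].
Proof. by rewrite /hermC !gzE. Qed.

Lemma N_0_iE : N_0_i R = mx3
  [:: [:: gz 1 0; gz 0 0; gz 0 0];
      [:: gz 0 0; gz 1 0; gz 0 0];
      [:: gz 0 1; gz 0 0; gz 1 0]].
Proof. by rewrite /N_0_i !gzE. Qed.

Lemma N_1i_1E : N_1i_1 R = mx3
  [:: [:: gz 1 0; gz 0 0; gz 0 0];
      [:: gz 1 1; gz 1 0; gz 0 0];
      [:: gz 1 0; gz 1 (-1); gz 1 0]].
Proof.
(* ['i] is convertible to [gz 0 1]; writing it so lets [gzE] add the two terms. *)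
transitivity (mx3 [:: [:: gz 1 0; gz 0 0; gz 0 0];
      [:: gz 1 0 + gz 0 1; gz 1 0; gz 0 0];
      [:: gz 1 0; gz 1 0 - gz 0 1; gz 1 0]]); first by [].
by rewrite !gzE.
Qed.

Lemma M_iE : M_i R = mx3
  [:: [:: gz 0 1; gz 0 0; gz 0 0];
      [:: gz 0 0; gz (-1) 0; gz 0 0];
      [:: gz 0 0; gz 0 0; gz 0 1]].
Proof. by rewrite /M_i !gzE. Qed.

Lemma invJE : invJ R = mx3
  [:: [:: gz 0 0; gz 0 0; gz (-1) 0];
      [:: gz 0 0; gz (-1) 0; gz 0 0];
      [:: gz (-1) 0; gz 0 0; gz 0 0]].
Proof. by rewrite /invJ !gzE. Qed.

Definition genE := (hermCE, N_0_iE, N_1i_1E, M_iE, invJE).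

Lemma generators_picard : generators `<=` picard R.
Proof.
move=> G genG; split; first split.
- by case: genG => [[[]|]|] ->; rewrite genE det3 !mx3E !gzE.
- case: genG => [[[]|]|] ->; apply/matrixP; elim/forall_I3; elim/forall_I3;
    by rewrite !mulmx3E ![(_ ^t*) _ _]mxE ![trmx _ _ _]mxE !genE !mx3E !gzE.
- case: genG => [[[]|]|] ->; rewrite genE => i j; move: i j.
  all: by elim/forall_I3; elim/forall_I3; rewrite mx3E; eexists; eexists.
Qed.

(** * The Picard modular group is a group *)

Definition gaussian_mx (G : 'M[C]_3) := forall i j, gaussian_integer (G i j).

Lemma gaussian_mxM G K : gaussian_mx G -> gaussian_mx K -> gaussian_mx (G *m K).
Proof.
move=> iG iK i j; rewrite mulmx3E.
have [a0 [b0 ->]] := iG i 0; have [a1 [b1 ->]] := iG i 1.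
have [a2 [b2 ->]] := iG i 2; have [c0 [d0 ->]] := iK 0 j.
have [c1 [d1 ->]] := iK 1 j; have [c2 [d2 ->]] := iK 2 j.
by rewrite -!/(gz _ _) !gzE; eexists; eexists.
Qed.

Lemma gaussian_mx_conj G : gaussian_mx G -> gaussian_mx (G ^t*).
Proof.
move=> iG i j; rewrite !mxE; have [a [b ->]] := iG j i.
by exists a, (- b); apply: gz_conj.
Qed.

Lemma gaussian_hermC : gaussian_mx (hermC R).
Proof.
by rewrite hermCE; elim/forall_I3; elim/forall_I3; rewrite mx3E; eexists; eexists.
Qed.

Lemma picard_subgroup : unit_subgroup (picard R).
Proof.
have U G : SU21 R G -> G \is a GRing.unit.
  by move=> [dG _]; rewrite -[_ \is a _]/(G \in unitmx) unitmxE dG unitr1.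
have CC : hermC R *m hermC R = 1.
  apply/matrixP; elim/forall_I3; elim/forall_I3;
    by rewrite !mulmx3E [RHS]mxE !mx3E /= !(mul0r,mulr0,mulrNN,mulr1,addr0,add0r).
split.
- by move=> G [/U].
- split=> [|i j]; last first.
    rewrite mxE; case: eqP => _; first by exists 1, 0.
    by exists 0, 0.
  by split; rewrite ?det1 // trmx1 map_mx1 mul1mx mulmx1.
- move=> G K [[dG hG] iG] [[dK hK] iK]; split; last exact: gaussian_mxM.
  split; first by rewrite det_mulmx dG dK mulr1.
  rewrite trmx_mul map_mxM !mulmxA -(mulmxA _ _ (hermC R)).
  by rewrite -(mulmxA _ _ G) hG.
- move=> G [SG iG]; have uG := U _ SG; have [dG hG] := SG.
  have GV : G *m G^-1 = 1 by exact: mulrV.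
  (* As C is its own inverse, the unitarity relation expresses the inverse through the conjugate
     transpose, so the inverse has Gaussian entries again. *)
  have VG : G^-1 = hermC R *m G ^t* *m hermC R.
    apply: (mulIr uG); rewrite mulVr // -[RHS]/(_ *m G).
    by rewrite -(mulmxA (hermC R)) -(mulmxA (hermC R)) hG CC.
  split; first split.
  + by rewrite -[_^-1]/(invmx G) det_inv dG invr1.
  + rewrite -{1}hG !mulmxA -map_mxM -trmx_mul GV trmx1 map_mx1 mul1mx.
    by rewrite -(mulmxA _ G) GV mulmx1.
  + rewrite VG; apply: gaussian_mxM; last exact: gaussian_hermC.
    by apply: gaussian_mxM; [exact: gaussian_hermC|exact: gaussian_mx_conj].
Qed.

(** * Action of the generators on Gaussian vectors, and orbits *)

Definition gvec (a1 a2 b1 b2 c1 c2 : int) : 'cV[C]_3 :=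
  \col_i nth 0 [:: gz a1 a2; gz b1 b2; gz c1 c2] i.

Lemma gvecE a1 a2 b1 b2 c1 c2 : let v := gvec a1 a2 b1 b2 c1 c2 in
  ((v 0 0 = gz a1 a2) * (v 1 0 = gz b1 b2) * (v 2 0 = gz c1 c2))%type.
Proof. by rewrite /= !mxE. Qed.

Ltac gvec_calc :=
  rewrite genE; apply/matrixP => + j; rewrite ord1; elim/forall_I3;
  rewrite mulmx3E !mx3E !gvecE !gzE; congr gz; ring.

Lemma N_0_i_gvec a1 a2 b1 b2 c1 c2 :
  N_0_i R *m gvec a1 a2 b1 b2 c1 c2 = gvec a1 a2 b1 b2 (c1 - a2) (c2 + a1).
Proof. gvec_calc. Qed.

Lemma N_1i_1_gvec a1 a2 b1 b2 c1 c2 :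
  N_1i_1 R *m gvec a1 a2 b1 b2 c1 c2 =
  gvec a1 a2 (b1 + a1 - a2) (b2 + a1 + a2)
       (c1 + a1 + b1 + b2) (c2 + a2 + b2 - b1).
Proof. gvec_calc. Qed.

Lemma M_i_gvec a1 a2 b1 b2 c1 c2 :
  M_i R *m gvec a1 a2 b1 b2 c1 c2 = gvec (- a2) a1 (- b1) (- b2) (- c2) c1.
Proof. gvec_calc. Qed.

Lemma invJ_gvec a1 a2 b1 b2 c1 c2 :
  invJ R *m gvec a1 a2 b1 b2 c1 c2 = gvec (- c1) (- c2) (- b1) (- b2) (- a1) (- a2).
Proof. gvec_calc. Qed.

Section Orbit.
Variable S : set 'M[C]_3.
Hypothesis S_picard : S `<=` picard R.

Definition orbit (v w : 'cV[C]_3) :=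
  exists2 h, subgroup_generated S h & h *m v = w.

Let genS := unit_subgroup_generated picard_subgroup S_picard.

Lemma orbit_refl v : orbit v v.
Proof. by have [_ S1 _ _] := genS; exists 1; rewrite ?mul1mx. Qed.

Lemma orbit_gen g v w : S g -> g *m v = w -> orbit v w.
Proof. by move=> Sg gv; exists g => //; apply: sub_gen_smallest. Qed.

Lemma orbit_trans u v w : orbit u v -> orbit v w -> orbit u w.
Proof.
have [_ _ SM _] := genS; move=> [h Sh <-] [k Sk <-].
by exists (k * h); [apply: SM|rewrite mulmxA].
Qed.

Lemma orbit_sym v w : orbit v w -> orbit w v.
Proof.
have [SU _ _ SV] := genS; move=> [h Sh <-]; exists h^-1; first exact: SV.
by rewrite mulmxA -[_ *m h]/(h^-1 * h) mulVr ?mul1mx //; apply: SU.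
Qed.

End Orbit.

Lemma orbitS (S T : set 'M[C]_3) v w : S `<=` T -> orbit S v w -> orbit T v w.
Proof.
move=> ST [h Sh hv]; exists h => // Q [QQ TQ].
by apply: Sh; split=> // x /ST /TQ.
Qed.

(** These are the lower triangular generators, which preserve the line of e3. They are kept apart
    from [invJ] so that the third column can be reduced without spoiling the first. *)
Definition cusp_generators := [set N_0_i R; N_1i_1 R; M_i R].

Lemma cusp_generators_sub : cusp_generators `<=` generators.
Proof. by move=> x; left. Qed.

Lemma cusp_generators_picard : cusp_generators `<=` picard R.
Proof. by move=> x /cusp_generators_sub /generators_picard. Qed.

(** * Reduction of isotropic vectors by the lower triangular generators *)

Local Notation cusp_orbit := (orbit cusp_generators).
Let cusp_trans := orbit_trans cusp_generators_picard.
Let cusp_sym := orbit_sym cusp_generators_picard.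

Lemma cusp_orbit_N0 a1 a2 b1 b2 c1 c2 :
  cusp_orbit (gvec a1 a2 b1 b2 c1 c2) (gvec a1 a2 b1 b2 (c1 - a2) (c2 + a1)).
Proof. by apply: (orbit_gen _ (N_0_i_gvec _ _ _ _ _ _)); left; left. Qed.

(** Inverse translations come from the symmetry of orbits, applied to the step that starts at the
    target vector; no inverse matrix is computed. *)
Lemma cusp_orbit_N0V a1 a2 b1 b2 c1 c2 :
  cusp_orbit (gvec a1 a2 b1 b2 c1 c2) (gvec a1 a2 b1 b2 (c1 + a2) (c2 - a1)).
Proof.
have := cusp_sym (cusp_orbit_N0 a1 a2 b1 b2 (c1 + a2) (c2 - a1)).
by rewrite addrK subrK.
Qed.

Lemma cusp_orbit_N1 a1 a2 b1 b2 c1 c2 :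
  cusp_orbit (gvec a1 a2 b1 b2 c1 c2)
    (gvec a1 a2 (b1 + a1 - a2) (b2 + a1 + a2)
          (c1 + a1 + b1 + b2) (c2 + a2 + b2 - b1)).
Proof. by apply: (orbit_gen _ (N_1i_1_gvec _ _ _ _ _ _)); left; right. Qed.

Lemma cusp_orbit_N1V a1 a2 b1 b2 c1 c2 :
  cusp_orbit (gvec a1 a2 b1 b2 c1 c2)
    (gvec a1 a2 (b1 - a1 + a2) (b2 - a1 - a2)
          (c1 + a1 - b1 - b2) (c2 + a2 - b2 + b1)).
Proof.
have := cusp_sym (cusp_orbit_N1 a1 a2 (b1 - a1 + a2) (b2 - a1 - a2)
  (c1 + a1 - b1 - b2) (c2 + a2 - b2 + b1)).
by congr (cusp_orbit (gvec _ _ _ _ _ _) _); ring.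
Qed.

Lemma cusp_orbit_M a1 a2 b1 b2 c1 c2 :
  cusp_orbit (gvec a1 a2 b1 b2 c1 c2) (gvec (- a2) a1 (- b1) (- b2) (- c2) c1).
Proof. by apply: (orbit_gen _ (M_i_gvec _ _ _ _ _ _)); right. Qed.

(** This is the vanishing of the Hermitian form of [hermC] at (a, b, c). *)
Definition isotropic (a1 a2 b1 b2 c1 c2 : int) :=
  b1 ^+ 2 + b2 ^+ 2 = 2 * (a1 * c1 + a2 * c2).

(** With s and t as in [translation_choice], [N_1i_1] changes |b|^2 by 2 (|a|^2 + s) and its inverse
    by 2 (|a|^2 - s). Applying [M_i] first replaces s by t, so one of the four moves decreases
    |b|^2. *)
Lemma cusp_translation_step a1 a2 b1 b2 c1 c2 :
  0 < a1 ^+ 2 + a2 ^+ 2 ->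
  isotropic a1 a2 b1 b2 c1 c2 -> a1 ^+ 2 + a2 ^+ 2 < b1 ^+ 2 + b2 ^+ 2 ->
  exists a1' a2' b1' b2' c1' c2',
  [/\ cusp_orbit (gvec a1 a2 b1 b2 c1 c2) (gvec a1' a2' b1' b2' c1' c2'),
      isotropic a1' a2' b1' b2' c1' c2',
      a1' ^+ 2 + a2' ^+ 2 = a1 ^+ 2 + a2 ^+ 2 &
      b1' ^+ 2 + b2' ^+ 2 < b1 ^+ 2 + b2 ^+ 2].
Proof.
rewrite /isotropic => a_gt0 iso lt_ab.
have [lt1|lt1|lt1|lt1] := translation_choice a_gt0 lt_ab; do 6!eexists; split.
(* Each orbit goal fixes the six witnesses of its case and leaves three integer goals behind, hence
   the numbers 1, 4, 7, 10. *)
1: exact: cusp_orbit_N1.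
4: exact: cusp_orbit_N1V.
7: exact: cusp_trans (cusp_orbit_M _ _ _ _ _ _) (cusp_orbit_N1 _ _ _ _ _ _).
10: exact: cusp_trans (cusp_orbit_M _ _ _ _ _ _) (cusp_orbit_N1V _ _ _ _ _ _).
all: lra.
Qed.

Lemma cusp_reduce_b a1 a2 b1 b2 c1 c2 :
  0 < a1 ^+ 2 + a2 ^+ 2 -> isotropic a1 a2 b1 b2 c1 c2 ->
  exists a1' a2' b1' b2' c1' c2',
  [/\ cusp_orbit (gvec a1 a2 b1 b2 c1 c2) (gvec a1' a2' b1' b2' c1' c2'),
      isotropic a1' a2' b1' b2' c1' c2',
      a1' ^+ 2 + a2' ^+ 2 = a1 ^+ 2 + a2 ^+ 2 &
      b1' ^+ 2 + b2' ^+ 2 <= a1' ^+ 2 + a2' ^+ 2].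
Proof.
have [n] := ubnP (absz (b1 ^+ 2 + b2 ^+ 2)).
elim: n a1 a2 b1 b2 c1 c2 => // n IHn a1 a2 b1 b2 c1 c2 ltn a_gt0 iso.
have [le_ba|lt_ab] := leP (b1 ^+ 2 + b2 ^+ 2) (a1 ^+ 2 + a2 ^+ 2).
  exists a1, a2, b1, b2, c1, c2; split=> //.
  exact: (orbit_refl cusp_generators_picard).
have [d1 [d2 [e1 [e2 [f1 [f2 [orb1 iso1 Nd lt1]]]]]]] :=
  cusp_translation_step a_gt0 iso lt_ab.
have ltn1 : (absz (e1 ^+ 2 + e2 ^+ 2)%R < n)%N.
  have : 0 <= e1 ^+ 2 + e2 ^+ 2 by rewrite addr_ge0 ?sqr_ge0.
  by move: (_ + _) (b1 ^+ 2 + b2 ^+ 2) lt1 ltn => x y; clear; lia.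
rewrite -Nd in a_gt0 *.
have [x1 [x2 [y1 [y2 [z1 [z2 [orb2 iso2 <- le2]]]]]]] := IHn _ _ _ _ _ _ ltn1 a_gt0 iso1.
by exists x1, x2, y1, y2, z1, z2; split=> //; apply: cusp_trans orb1 orb2.
Qed.

(** [N_0_i] adds i a to c. This keeps Re(conj(a) c), hence isotropy, and adds |a|^2 to Im(conj(a)
    c). As long as twice the absolute value of the latter exceeds |a|^2, a shift towards zero makes
    it strictly smaller. *)
Lemma cusp_reduce_c a1 a2 b1 b2 c1 c2 :
  0 < a1 ^+ 2 + a2 ^+ 2 -> isotropic a1 a2 b1 b2 c1 c2 ->
  exists c1' c2',
  [/\ cusp_orbit (gvec a1 a2 b1 b2 c1 c2) (gvec a1 a2 b1 b2 c1' c2'),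
      isotropic a1 a2 b1 b2 c1' c2' &
      2 * `|a1 * c2' - a2 * c1'| <= a1 ^+ 2 + a2 ^+ 2].
Proof.
have [n] := ubnP (absz (a1 * c2 - a2 * c1)%R).
elim: n c1 c2 => // n IHn c1 c2 ltn a_gt0 iso.
have [le_ca|lt_ac] := leP (2 * `|a1 * c2 - a2 * c1|) (a1 ^+ 2 + a2 ^+ 2).
  by exists c1, c2; split=> //; apply: (orbit_refl cusp_generators_picard).
have [d1 [d2 [orb1 iso1 ltn1]]] : exists d1 d2,
  [/\ cusp_orbit (gvec a1 a2 b1 b2 c1 c2) (gvec a1 a2 b1 b2 d1 d2),
      isotropic a1 a2 b1 b2 d1 d2 &
      (absz (a1 * d2 - a2 * d1)%R < n)%N].
  have [m_ge0|m_lt0] := leP 0 (a1 * c2 - a2 * c1).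
  - exists (c1 + a2), (c2 - a1); split; first exact: cusp_orbit_N0V.
      by move: iso; rewrite /isotropic => ->; ring.
    have -> : a1 * (c2 - a1) - a2 * (c1 + a2) =
      (a1 * c2 - a2 * c1) - (a1 ^+ 2 + a2 ^+ 2) by ring.
    move: m_ge0 a_gt0 lt_ac ltn.
    by move: (a1 ^+ 2 + _) (a1 * c2 - _) => y x; clear; lia.
  - exists (c1 - a2), (c2 + a1); split; first exact: cusp_orbit_N0.
      by move: iso; rewrite /isotropic => ->; ring.
    have -> : a1 * (c2 + a1) - a2 * (c1 - a2) =
      (a1 * c2 - a2 * c1) + (a1 ^+ 2 + a2 ^+ 2) by ring.
    move: m_lt0 a_gt0 lt_ac ltn.
    by move: (a1 ^+ 2 + _) (a1 * c2 - _) => y x; clear; lia.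
have [z1 [z2 [orb2 iso2 le2]]] := IHn _ _ ltn1 a_gt0 iso1.
by exists z1, z2; split=> //; apply: cusp_trans orb1 orb2.
Qed.

Lemma cusp_reduce a1 a2 b1 b2 c1 c2 :
  0 < a1 ^+ 2 + a2 ^+ 2 -> isotropic a1 a2 b1 b2 c1 c2 ->
  exists a1' a2' b1' b2' c1' c2',
  [/\ cusp_orbit (gvec a1 a2 b1 b2 c1 c2) (gvec a1' a2' b1' b2' c1' c2'),
      isotropic a1' a2' b1' b2' c1' c2',
      a1' ^+ 2 + a2' ^+ 2 = a1 ^+ 2 + a2 ^+ 2,
      b1' ^+ 2 + b2' ^+ 2 <= a1' ^+ 2 + a2' ^+ 2 &
      2 * (c1' ^+ 2 + c2' ^+ 2) <= a1' ^+ 2 + a2' ^+ 2].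
Proof.
move=> a_gt0 iso.
have [d1 [d2 [e1 [e2 [f1 [f2 [orb1 iso1 Nd le1]]]]]]] := cusp_reduce_b a_gt0 iso.
rewrite -Nd in a_gt0 *.
have [z1 [z2 [orb2 iso2 le2]]] := cusp_reduce_c a_gt0 iso1.
exists d1, d2, e1, e2, z1, z2; split=> //; first exact: cusp_trans orb1 orb2.
(* After multiplication by |a|^2 the left side splits through |conj(a) c|^2, the sum of the squares
   of the real and imaginary parts. Isotropy makes the real part |b|^2 / 2. *)
rewrite -(ler_pM2l a_gt0).
have -> : (d1 ^+ 2 + d2 ^+ 2) * (2 * (z1 ^+ 2 + z2 ^+ 2)) =
  2 * (d1 * z1 + d2 * z2) ^+ 2 + 2 * (d1 * z2 - d2 * z1) ^+ 2 by ring.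
have e0 : 0 <= e1 ^+ 2 + e2 ^+ 2 by rewrite addr_ge0 ?sqr_ge0.
rewrite iso2 in le1 e0.
rewrite -(real_normK (num_real (d1 * z2 - d2 * z1))).
have := normr_ge0 (d1 * z2 - d2 * z1).
move: le1 le2 e0 a_gt0.
move: (d1 * z1 + _) (d1 ^+ 2 + _) (`|_|) => x n y; clear => lex ley x0 n0 y0.
(* The two products say 4 x^2 <= n^2 and 4 y^2 <= n^2; half their sum is the goal. *)
have : 0 <= (n - 2 * x) * (n + 2 * x) by apply: mulr_ge0; lra.
have : 0 <= (n - 2 * y) * (n + 2 * y) by apply: mulr_ge0; lra.
lra.
Qed.

(** Descent on |a|^2: after reduction |c|^2 is at most half of |a|^2, and [invJ] moves - c to the
    front. The descent stops at a = 0, where isotropy forces b = 0. *)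
Lemma orbit_to_cusp a1 a2 b1 b2 c1 c2 : isotropic a1 a2 b1 b2 c1 c2 ->
  exists c1' c2', orbit generators (gvec a1 a2 b1 b2 c1 c2) (gvec 0 0 0 0 c1' c2').
Proof.
have [n] := ubnP (absz (a1 ^+ 2 + a2 ^+ 2)).
elim: n a1 a2 b1 b2 c1 c2 => // n IHn a1 a2 b1 b2 c1 c2 ltn iso.
have : 0 <= a1 ^+ 2 + a2 ^+ 2 by rewrite addr_ge0 ?sqr_ge0.
rewrite le_eqVlt => /predU1P[/esym/sqrz_sum_eq0[a10 a20]|a_gt0].
  subst a1 a2; move: iso; rewrite /isotropic !mul0r addr0 mulr0 => /sqrz_sum_eq0[-> ->].
  by exists c1, c2; apply: orbit_refl; apply: generators_picard.
have [d1 [d2 [e1 [e2 [f1 [f2 [orb1 iso1 Nd _ le_cd]]]]]]] := cusp_reduce a_gt0 iso.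
rewrite -Nd in a_gt0 ltn.
have ltn1 : (absz ((- f1) ^+ 2 + (- f2) ^+ 2)%R < n)%N.
  rewrite !sqrrN; have : 0 <= f1 ^+ 2 + f2 ^+ 2 by rewrite addr_ge0 ?sqr_ge0.
  move: a_gt0 ltn le_cd; move: (f1 ^+ 2 + _) (d1 ^+ 2 + _) => x y; clear; lia.
have iso2 : isotropic (- f1) (- f2) (- e1) (- e2) (- d1) (- d2).
  by move: iso1; rewrite /isotropic !sqrrN => ->; ring.
have [z1 [z2 orb2]] := IHn _ _ _ _ _ _ ltn1 iso2.
exists z1, z2; apply: orbit_trans orb2; first exact: generators_picard.
apply: orbit_trans (orbitS cusp_generators_sub orb1) _; first exact: generators_picard.
by apply: (orbit_gen _ (invJ_gvec _ _ _ _ _ _)); right.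
Qed.

(** * From orbits of columns back to matrices *)

Local Notation genH := (subgroup_generated generators).

Lemma genH_subgroup : unit_subgroup genH.
Proof. exact: unit_subgroup_generated picard_subgroup generators_picard. Qed.

Lemma genH_picard : genH `<=` picard R.
Proof. exact: smallest_sub picard_subgroup generators_picard. Qed.

Lemma genH_cancel h G : genH h -> genH (h *m G) -> genH G.
Proof.
have [HU _ HM HV] := genH_subgroup => Hh HhG.
by rewrite -[G](mulKr (HU h Hh)); apply: HM => //; apply: HV.
Qed.

Lemma picard_mul h G : genH h -> picard R G -> picard R (h *m G).
Proof.
have [_ _ PM _] := picard_subgroup.
by move=> /genH_picard Ph PG; apply: (PM _ _ Ph PG).
Qed.

(** This is the unitarity relation read at one entry: the Hermitian product of columns j and k of
    G. *)
Lemma picard_herm (G : 'M[C]_3) j k : picard R G ->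
  - ((G 0 j)^* * G 2 k) + (G 1 j)^* * G 1 k - (G 2 j)^* * G 0 k = hermC R j k.
Proof.
move=> [[_ /matrixP/(_ j k) <-] _].
by rewrite !mulmx3E ![(_ ^t*) _ _]mxE ![trmx _ _ _]mxE !mx3E; ring.
Qed.

Lemma picard_col (G : 'M[C]_3) j : picard R G ->
  exists a1 a2 b1 b2 c1 c2, col j G = gvec a1 a2 b1 b2 c1 c2.
Proof.
move=> [_ iG]; have [a1 [a2 Ea]] := iG 0 j; have [b1 [b2 Eb]] := iG 1 j.
have [c1 [c2 Ec]] := iG 2 j; exists a1, a2, b1, b2, c1, c2.
by apply/matrixP; elim/forall_I3 => k; rewrite ord1 mxE gvecE.
Qed.

Lemma col_gvecE (G : 'M[C]_3) j a1 a2 b1 b2 c1 c2 :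
  col j G = gvec a1 a2 b1 b2 c1 c2 ->
  [/\ G 0 j = gz a1 a2, G 1 j = gz b1 b2 & G 2 j = gz c1 c2].
Proof.
by move=> /matrixP Ej; split; [have := Ej 0 0|have := Ej 1 0|have := Ej 2 0];
  rewrite mxE gvecE.
Qed.

Lemma picard_isotropic (G : 'M[C]_3) j a1 a2 b1 b2 c1 c2 : picard R G ->
  hermC R j j = 0 -> col j G = gvec a1 a2 b1 b2 c1 c2 ->
  isotropic a1 a2 b1 b2 c1 c2.
Proof.
move=> PG hj /col_gvecE[E0 E1 E2]; have := picard_herm j j PG.
rewrite hj E0 E1 E2 !gzE => /gz_inj[+ _]; rewrite /isotropic; lra.
Qed.

(** Products and inverses of the lower triangular generators still have e3 as an eigenvector, so
    multiplying by them on the left keeps a first column that is a multiple of e3. *)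
Lemma cusp_generated_col2 h : subgroup_generated cusp_generators h ->
  h 0 2 = 0 /\ h 1 2 = 0.
Proof.
pose P := [set h : 'M[C]_3 | [/\ h \is a GRing.unit, h 0 2 = 0 & h 1 2 = 0]].
suff PP : unit_subgroup P.
  move=> /(_ P)[] //; split=> // x Sx; split; last 2 first.
  - by case: Sx => [[]|] ->; rewrite mx3E.
  - by case: Sx => [[]|] ->; rewrite mx3E.
  - by have [PU _ _ _] := picard_subgroup; apply: PU; apply: cusp_generators_picard.
split; first by move=> x [].
- by split; [exact: unitr1|rewrite mxE..].
- move=> x y [Ux x0 x1] [Uy y0 y1]; split; first by rewrite unitrMl.
  - by rewrite [LHS]mulmx3E x0 y0 y1 !(mulr0, mul0r, addr0).
  - by rewrite [LHS]mulmx3E x1 y0 y1 !(mulr0, mul0r, addr0).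
- move=> x [Ux x0 x1].
  (* The last column of x^-1 x = 1 is the last column of x^-1 times [x 2 2]. Its last entry shows
     that [x 2 2] is nonzero, and then the other two entries of x^-1 must vanish. *)
  have := mulVr Ux; rewrite -[_ * x]/(_ *m x) => /matrixP E.
  have := E 0 2; have := E 1 2; have := E 2 2.
  rewrite !mulmx3E x0 x1 !mxE !(mulr0, add0r) /= => E2 E1 E0.
  have x2 : x 2 2 != 0.
    by apply: contra_eq_neq E2 => ->; rewrite mulr0 eq_sym oner_eq0.
  by split; [rewrite unitrV|apply: (mulIf x2); rewrite mul0r..].
Qed.

(** The matrices M_i^k J have this shape, with u = - i^k and v = - (-1)^k. *)
Definition antidiag (u1 u2 v1 v2 : int) : 'M[C]_3 :=
  mx3 [:: [:: gz 0 0; gz 0 0; gz u1 u2];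
          [:: gz 0 0; gz v1 v2; gz 0 0];
          [:: gz u1 u2; gz 0 0; gz 0 0]].

Lemma genH_antidiagM u1 u2 v1 v2 :
  genH (antidiag u1 u2 v1 v2) -> genH (antidiag (- u2) u1 (- v1) (- v2)).
Proof.
have [_ _ HM _] := genH_subgroup => Ha.
have -> : antidiag (- u2) u1 (- v1) (- v2) = M_i R * antidiag u1 u2 v1 v2.
  apply/matrixP; elim/forall_I3; elim/forall_I3;
    by rewrite mulmx3E genE !mx3E !gzE; congr gz; ring.
by apply: HM Ha; apply: sub_gen_smallest; left; right.
Qed.

(** The product of the outer columns makes their nonzero entries equal to one Gaussian unit a.
    Orthogonality to the middle column kills its outer entries, and the determinant gives the
    central entry - a^-2. This leaves the four matrices M_i^k J. *)
Lemma antidiag_generated (G : 'M[C]_3) a1 a2 : picard R G ->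
  G 0 0 = 0 -> G 1 0 = 0 -> col 2 G = gvec a1 a2 0 0 0 0 -> genH G.
Proof.
move=> PG G00 G10 /col_gvecE [G02 G12 G22].
have [b1 [b2 [d1 [d2 [e1 [e2 /col_gvecE[G01 G11 G21]]]]]]] := picard_col 1 PG.
have [_ [_ [_ [_ [c1 [c2 /col_gvecE[_ _ G20]]]]]]] := picard_col 0 PG.
have := picard_herm 0 2 PG; have := picard_herm 0 1 PG; have := picard_herm 2 1 PG.
have [[dG _] _] := PG; move: dG.
rewrite det3 !mx3E G00 G10 G20 G01 G11 G21 G02 G12 G22 !gzE.
move=> /gz_inj[dG1 dG2] /gz_inj[h21 h21'] /gz_inj[h01 h01'] /gz_inj[h02 h02'].
have [] := @gaussian_units a1 a2 c1 c2; [lra|lra|move=> Ec1 Ec2 _ Ea].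
subst c1 c2.
have HJ : genH (antidiag (-1) 0 (-1) 0).
  by rewrite /antidiag -invJE; apply: sub_gen_smallest; right.
have -> : G = antidiag a1 a2 d1 d2.
  have [? [? [? ?]]] : b1 = 0 /\ b2 = 0 /\ e1 = 0 /\ e2 = 0.
    by case: Ea => [[]|[]|[]|[]] ? ?; subst a1 a2; lia.
  subst; apply/matrixP; elim/forall_I3; elim/forall_I3;
    by rewrite /antidiag !mx3E.
(* The corner entry of J is -1, and each factor [M_i] multiplies it by i: the entries 1, -1, i, - i
   take 2, 0, 3, 1 factors. *)
case: Ea => [[]|[]|[]|[]] E1 E2; subst a1 a2.
- have [-> ->] : d1 = -1 /\ d2 = 0 by lia.
  exact: genH_antidiagM (genH_antidiagM HJ).
- by have [-> ->] : d1 = -1 /\ d2 = 0 by lia.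
- have [-> ->] : d1 = 1 /\ d2 = 0 by lia.
  exact: genH_antidiagM (genH_antidiagM (genH_antidiagM HJ)).
- have [-> ->] : d1 = 1 /\ d2 = 0 by lia.
  exact: genH_antidiagM HJ.
Qed.

Lemma picard_generated G : picard R G -> genH G.
Proof.
move=> PG; have [a1 [a2 [b1 [b2 [c1 [c2 E0]]]]]] := picard_col 0 PG.
have h00 : hermC R 0 0 = 0 by rewrite mx3E.
have [x1 [x2 [h Hh hE0]]] := orbit_to_cusp (picard_isotropic PG h00 E0).
apply: (genH_cancel Hh); have := picard_mul Hh PG.
rewrite -E0 -col_mul in hE0.
move: (h *m G) hE0 => {PG E0 Hh h}G /col_gvecE[G00 G10 G20] PG.
have [{}a1 [{}a2 [{}b1 [{}b2 [{}c1 [{}c2 E2]]]]]] := picard_col 2 PG.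
have h22 : hermC R 2 2 = 0 by rewrite mx3E.
have iso := picard_isotropic PG h22 E2.
have [G02 G12 G22] := col_gvecE E2.
(* The first column is now (0, 0, x), so its product with the third column reads conj(x) a = 1, and
   a is a unit. *)
have := picard_herm 0 2 PG; rewrite G00 G10 G20 G02 G12 G22 mx3E !gzE => /gz_inj[re im].
have [] := @gaussian_units a1 a2 x1 x2; [lra|lra|move=> _ _ Na _].
have a_gt0 : 0 < a1 ^+ 2 + a2 ^+ 2 by rewrite Na.
have [d1 [d2 [e1 [e2 [f1 [f2 [[h Ch hE2] iso2 Nd le_e le_f]]]]]]] := cusp_reduce a_gt0 iso.
rewrite Nd Na in le_e le_f.
(* Since |a| = 1, the bound is 2 |f|^2 <= 1, which forces f = 0 over the integers; isotropy then
   forces e = 0. *)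
have [f10 f20] : f1 = 0 /\ f2 = 0.
  apply: sqrz_sum_eq0; have : 0 <= f1 ^+ 2 + f2 ^+ 2 by rewrite addr_ge0 ?sqr_ge0.
  by move: le_f; move: (_ + _) => x; clear; lia.
subst f1 f2.
have [e10 e20] : e1 = 0 /\ e2 = 0.
  by apply: sqrz_sum_eq0; rewrite iso2; ring.
subst e1 e2.
have Hh : genH h by move=> Q [QQ SQ]; apply: Ch; split=> // x /cusp_generators_sub /SQ.
have [h02 h12] := cusp_generated_col2 Ch.
apply: (genH_cancel Hh); apply: (@antidiag_generated _ d1 d2).
- exact: picard_mul.
- by rewrite mulmx3E G00 G10 h02 -gz0 !mulr0 mul0r !addr0.
- by rewrite mulmx3E G00 G10 h12 -gz0 !mulr0 mul0r !addr0.
- by rewrite col_mul E2.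
Qed.

End Picard.

Theorem theorem1 (R : realType) :
  subgroup_generated [set N_0_i R; N_1i_1 R; M_i R; invJ R] = picard R.
Proof.
apply/seteqP; split=> G; first exact: genH_picard.
exact: picard_generated.
Qed.
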